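(* Let $R$ be an integral domain and $M$ a nonzero, non-simple unital $R$-module. Then $D(M)$ is the discrete topology if and only if every element $m\in M^{\#}$ is irreducible on $M^{\#}$.
   Context: For $m,n\in M$ write $m\mid n$ if $n=rm$ for some $r\in R$ (equivalently $Rn\subseteq Rm$). Put $M^{\#}=\{0\neq m\in M: Rm\neq M\}$ and define an equivalence relation on $M^{\#}$ by $m\sim n$ iff $Rm=Rn$; let $[m]$ be the class of $m$ and $\operatorname{EC}(M^{\#})=\{[m]:m\in M^{\#}\}$. For $m\in M^{\#}$ let $U_m=\{[n]\in \operatorname{EC}(M^{\#}): n\mid m\}$. The family $\{U_m\}_{m\in M^{\#}}$ is a basis of a topology on $\operatorname{EC}(M^{\#})$, called the divisor topology of $M$ and denoted $D(M)$ (also denoting the resulting space). An element $m\in M^{\#}$ is irreducible on $M^{\#}$ if whenever $m_1\mid m$ for some $m_1\in M^{\#}$, then $m\mid m_1$. *)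

(* Defs.v *)
From HB Require Import structures.
From mathcomp Require Import all_boot all_order all_algebra generic_quotient.
From mathcomp Require Import boolp classical_sets topology.

Set Implicit Arguments.
Unset Strict Implicit.
Unset Printing Implicit Defensive.

Import GRing.Theory.
Local Open Scope classical_set_scope.
Local Open Scope ring_scope.
Local Open Scope quotient_scope.

Section DivisorTopology.
Variables (R : idomainType) (M : lmodType R).

Definition nonzero_module : Prop := exists m : M, m != 0.

Definition simple_module : Prop :=
  nonzero_module /\
  forall N : {pred M}, submod_closed N -> N =i pred1 0 \/ N =i predT.

Definition cyclic_submodule (m : M) : set M := [set r *: m | r in [set: R]].

Definition divides (m n : M) : Prop := exists r : R, n = r *: m.

(* M^#: the nonzero elements that do not generate M. *)
Definition sharp : set M := [set m | m != 0 /\ cyclic_submodule m <> setT].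

Definition irreducible_on_sharp (m : M) : Prop :=
  forall m1 : M, sharp m1 -> divides m1 m -> divides m m1.

Definition sharp_type : Type := set_type sharp.
HB.instance Definition _ := Choice.on sharp_type.

Definition sharp_rel (m n : sharp_type) : bool :=
  `[< cyclic_submodule (val m) = cyclic_submodule (val n) >].

Lemma sharp_rel_refl : reflexive sharp_rel.
Proof. by move=> m; apply/asboolP. Qed.

Lemma sharp_rel_sym : symmetric sharp_rel.
Proof. by move=> m n; apply/asboolP/asboolP. Qed.

Lemma sharp_rel_trans : transitive sharp_rel.
Proof. by move=> n m p /asboolP mn /asboolP np; apply/asboolP; rewrite mn. Qed.

Canonical sharp_equiv :=
  EquivRel sharp_rel sharp_rel_refl sharp_rel_sym sharp_rel_trans.

(* Rm = Rn is not decidable for a general R, so the quotient is taken by the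
   boolean reflection of this relation. *)
Definition EC : Type := {eq_quot sharp_equiv}.
HB.instance Definition _ := Choice.on EC.
HB.instance Definition _ := Quotient.on EC.

Definition EC_class (m : sharp_type) : EC := \pi_EC m.

Lemma EC_classE (m n : sharp_type) :
  EC_class m = EC_class n <->
  cyclic_submodule (val m) = cyclic_submodule (val n).
Proof.
split=> [/eqmodP/asboolP//|mn]; by apply/eqmodP/asboolP.
Qed.

(* U_m; n ranges over sharp_type, so only divisors lying in M^# count. *)
Definition divisor_nbhd (m : sharp_type) : set EC :=
  [set EC_class n | n in [set n | divides (val n) (val m)]].

Lemma divides_refl (m : M) : divides m m.
Proof. by exists 1; rewrite scale1r. Qed.

Lemma divides_trans (n m p : M) : divides m n -> divides n p -> divides m p.
Proof. by move=> [r ->] [s ->]; exists (s * r); rewrite scalerA. Qed.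

Lemma dividesP (m n : M) :
  divides m n <-> cyclic_submodule n `<=` cyclic_submodule m.
Proof.
split=> [[r ->] _ [s _ <-]|sub]; first by exists (s * r); rewrite ?scalerA.
have [r _ <-] : cyclic_submodule m n by apply: sub; exists 1; rewrite ?scale1r.
by exists r.
Qed.

Definition divisor_base : set (set EC) := range divisor_nbhd.

Lemma divisor_base_cover : \bigcup_(U in divisor_base) U = setT.
Proof.
apply/seteqP; split=> // x _; rewrite -(reprK x).
exists (divisor_nbhd (repr x)); first by exists (repr x).
by exists (repr x) => //; exact: divides_refl.
Qed.

Lemma divisor_base_join (U V : set EC) (x : EC) :
  divisor_base U -> divisor_base V -> U x -> V x ->
  exists W, [/\ divisor_base W, W x & W `<=` U `&` V].
Proof.
move=> [m _ <-] [n _ <-] [k km <-] [l ln] /EC_classE kl.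
exists (divisor_nbhd k); split; first by exists k.
  by exists k => //; exact: divides_refl.
have kn : divides (val k) (val n).
  by apply: divides_trans ln; apply/dividesP; rewrite kl.
by move=> _ [p pk <-]; split; exists p => //; exact: divides_trans pk _.
Qed.

Definition divisor_space : Type := EC.
HB.instance Definition _ := Choice.on divisor_space.
HB.instance Definition _ := isBaseTopological.Build divisor_space
  divisor_base_cover divisor_base_join.

Lemma divisor_space_openE (A : set divisor_space) :
  open A <-> exists2 B, B `<=` divisor_base & \bigcup_(U in B) U = A.
Proof. by split=> [[B sB <-]|[B sB <-]]; exists B. Qed.

End DivisorTopology.

Arguments sharp {R} M _.

(* Main.v *)
(* Both sides say that every [U_m] is the singleton [{[m]}]: [U_m] is the
   smallest open set containing [[m]]. *)
Require Import Defs.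
From mathcomp Require Import all_boot all_order all_algebra.
From mathcomp Require Import classical_sets topology.

Local Open Scope classical_set_scope.

(** If a basic set $U_n$ contains $[m]$, then $m\mid n$, so by transitivity it contains all of
    $U_m$. Hence $\{[m]\}$ is open iff every divisor of $m$ in $M^{\#}$ has the class of $m$, that
    is, iff $m$ is irreducible. Once all singletons are open, so is every union of them. *)

(** Divisibility depends only on the cyclic submodules, so any representative of the class can be
    tested. *)
Lemma divisor_nbhd_class {R : idomainType} {M : lmodType R}
    (m n : sharp_type M) :
  divisor_nbhd m (EC_class n) <-> divides (val n) (val m).
Proof.
split=> [[k km /EC_classE kn]|nm]; last by exists n.
by apply: divides_trans km; apply/dividesP; rewrite kn.
Qed.

Lemma EC_class_divides {R : idomainType} {M : lmodType R}
    (m n : sharp_type M) :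
  EC_class m = EC_class n <->
  divides (val m) (val n) /\ divides (val n) (val m).
Proof.
rewrite EC_classE; split=> [mn|[/dividesP nm /dividesP mn]].
  by split; apply/dividesP; rewrite mn.
exact/seteqP.
Qed.

Theorem theorem16 (R : idomainType) (M : lmodType R)
  (M_nonzero : nonzero_module M) (M_nonsimple : ~ simple_module M) :
  (forall A : set (divisor_space M), open A) <->
  (forall m : M, sharp M m -> irreducible_on_sharp m).
Proof.
split=> [discrete m m_sharp d d_sharp dm|irr A].
  pose m' : sharp_type M := SigSub (mem_set m_sharp).
  pose d' : sharp_type M := SigSub (mem_set d_sharp).
  (* Some basic $U_n$ lies inside $\{[m]\}$ and contains $[m]$; since $d\mid m\mid n$, it also
     contains $[d]$, forcing $[d]=[m]$. *)
  have /divisor_space_openE[B Bbase BE] := discrete [set EC_class m'].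
  have [U BU Um] : (\bigcup_(U in B) U) (EC_class m') by rewrite BE.
  have [n _ nU] := Bbase U BU.
  have m'n : divides m (val n) by apply/(divisor_nbhd_class n m'); rewrite nU.
  have Ud : U (EC_class d').
    by rewrite -nU; apply/divisor_nbhd_class; apply: divides_trans m'n.
  have : [set EC_class m'] (EC_class d') by rewrite -BE; exists U.
  by move=> /EC_class_divides[].
apply/divisor_space_openE.
(* These sets cover [A]; irreducibility of $m$ shrinks each $U_m$ to $\{[m]\}$, so none leaves
   [A]. *)
exists [set divisor_nbhd m | m in [set m | A (EC_class m)]].
  by move=> _ [m _ <-]; exists m.
apply/seteqP; split=> [_ [_ [m Am <-] [n nm <-]]|x Ax].
  suff -> : EC_class n = EC_class m by [].
  apply/EC_class_divides; split=> //.
  by apply: irr nm; exact: set_mem (valP _).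
have xE : EC_class (repr x) = x by exact: reprK.
exists (divisor_nbhd (repr x)); first by exists (repr x) => //=; rewrite xE.
by rewrite -{2}xE; apply/divisor_nbhd_class; exact: divides_refl.
Qed.
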